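(* Let $(\varPhi,\boldsymbol{y})$ be a relatively normalized surface of nonvanishing constant relative mean curvature $H$ in the Euclidean space $\mathbb{E}^3$. Then there is one relatively parallel surface to $(\varPhi,\boldsymbol{y})$ of constant relative curvature and another one of constant relative mean curvature.
   Context: Let $U\subset\mathbb{R}^2$ be a region and $\varPhi$ a $C^r$-surface in $\mathbb{E}^3$, $r\ge 3$, given by an injective $C^r$-immersion $\boldsymbol{x}=\boldsymbol{x}(u^1,u^2)$ on $U$ whose Gaussian curvature never vanishes. Write $\partial_i=\partial/\partial u^i$; repeated indices are summed over $1,2$. A $C^s$-relative normalization of $\varPhi$ ($r>s\ge1$) is a $C^s$-map $\boldsymbol{y}:U\to\mathbb{R}^3$ such that everywhere on $U$: $\operatorname{rank}\{\partial_1\boldsymbol{x},\partial_2\boldsymbol{x},\boldsymbol{y}\}=3$ and $\operatorname{rank}\{\partial_1\boldsymbol{x},\partial_2\boldsymbol{x},\partial_i\boldsymbol{y}\}=2$ for $i=1,2$. The pair $(\varPhi,\boldsymbol{y})$ is called a relatively normalized surface. The functions $B_i^j$ are defined by $\partial_i\boldsymbol{y}=-B_i^j\,\partial_j\boldsymbol{x}$. The eigenvalues $\kappa_1,\kappa_2$ of $(B_i^j)$ are the relative principal curvatures; the relative curvature is $K=\kappa_1\kappa_2=\det(B_i^j)$ and the relative mean curvature is $H$, where $2H=\kappa_1+\kappa_2=B_i^i$. It is assumed throughout that the relative lines of curvature (the curves on $\varPhi$ along which the lines in direction $\boldsymbol{y}$ form developable surfaces) are real, so that $H^2-K\ge0$.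 For a real constant $\mu\neq0$ such that $A:=\mu^2K-2\mu H+1\neq0$ everywhere on $U$, the surface $\varPhi^*$ parametrized by $\boldsymbol{x}^*=\boldsymbol{x}+\mu\,\boldsymbol{y}$ is regular and $\boldsymbol{y}$ is also a relative normalization of it; $(\varPhi^*,\boldsymbol{y})$ is called the relatively parallel surface to $(\varPhi,\boldsymbol{y})$ at relative distance $\mu$. Different values of $\mu$ give different relatively parallel surfaces. The relative curvature $K^*=\det(B^{*j}_{\ i})$ and relative mean curvature $H^*=\tfrac12B^{*i}_{\ i}$ of $(\varPhi^*,\boldsymbol{y})$ are obtained by replacing $\boldsymbol{x}$ by $\boldsymbol{x}^*$ in the definitions above, i.e. from $\partial_i\boldsymbol{y}=-B^{*j}_{\ i}\,\partial_j\boldsymbol{x}^*$.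
   Formalization: The existence of a parallel surface of constant relative curvature (resp. constant relative mean curvature) is proved assuming K (resp. H²−K) vanishes nowhere or identically on U; otherwise the only possible relative distance 1/(2H) (resp. 1/H) gives a singular surface and the claim fails. *)

(* Defs.v *)
From HB Require Import structures.
From mathcomp Require Import all_boot all_order all_algebra.
From mathcomp Require Import all_classical all_reals all_analysis.
From mathcomp Require Import ring.

Set Implicit Arguments.
Unset Strict Implicit.
Unset Printing Implicit Defensive.

Import Order.TTheory GRing.Theory Num.Theory.
Import numFieldNormedType.Exports.

Local Open Scope classical_set_scope.
Local Open Scope ring_scope.

Section Calculus.
Variables (R : realType) (n : nat).
Implicit Types (U : set 'rV[R]_2) (p : 'rV[R]_2).

Definition partial (i : 'I_2) (f : 'rV[R]_2 -> 'rV[R]_n.+1) p : 'rV[R]_n.+1 :=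
  'D_(delta_mx 0 i) f p.

Fixpoint Ck (k : nat) U (f : 'rV[R]_2 -> 'rV[R]_n.+1) : Prop :=
  match k with
  | 0 => forall p, U p -> {for p, continuous f}
  | k'.+1 => forall i : 'I_2,
      (forall p, U p -> derivable f p (delta_mx 0 i)) /\ Ck k' U (partial i f)
  end.

(* Row i is the partial derivative with respect to the i-th coordinate; this
   is the transpose of the usual Jacobian matrix. *)
Definition jac (f : 'rV[R]_2 -> 'rV[R]_n.+1) p : 'M[R]_(2, n.+1) :=
  \matrix_(i < 2) partial i f p.

End Calculus.

Definition region (R : realType) (U : set 'rV[R]_2) : Prop :=
  [/\ open U, connected U & U !=set0].

Definition constant_on (R : realType) (U : set 'rV[R]_2) (f : 'rV[R]_2 -> R) :
  Prop := exists c, forall p, U p -> f p = c.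

(* With H a nonzero constant, mu^2 K - 2 mu H + 1 equals K / (4 H^2) for
   mu = 1 / (2 H) and (K - H^2) / H^2 for mu = 1 / H. So if K (resp. H^2 - K)
   has a zero without vanishing identically, no relatively parallel surface
   regular on all of U has constant relative curvature (resp. constant
   relative mean curvature). *)
Definition nowhere_or_identically_zero (R : realType) (U : set 'rV[R]_2)
  (f : 'rV[R]_2 -> R) : Prop :=
  (forall p, U p -> f p != 0) \/ (forall p, U p -> f p = 0).

Section Surface.
Variable R : realType.
Implicit Types (U : set 'rV[R]_2) (x y : 'rV[R]_2 -> 'rV[R]_3) (p : 'rV[R]_2).

Definition dotp (u v : 'rV[R]_3) : R := \sum_k u 0 k * v 0 k.

(* The indices in 'I_3 are added modulo 3. *)
Definition crossp (u v : 'rV[R]_3) : 'rV[R]_3 :=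
  \row_(k < 3) (u 0 (k + 1) * v 0 (k + 2%:R) - u 0 (k + 2%:R) * v 0 (k + 1)).

Definition unit_normal x p : 'rV[R]_3 :=
  let N := crossp (partial 0 x p) (partial 1 x p) in
  (Num.sqrt (dotp N N))^-1 *: N.

Definition fform1 x p : 'M[R]_2 :=
  \matrix_(i, j) dotp (partial i x p) (partial j x p).

Definition fform2 x p : 'M[R]_2 :=
  \matrix_(i, j) dotp (partial j (partial i x) p) (unit_normal x p).

Definition gauss_curvature x p : R := \det (fform2 x p) / \det (fform1 x p).

Definition surface (r : nat) U x : Prop :=
  [/\ Ck r U x,
      set_inj U x,
      forall p, U p -> \rank (jac x p) = 2%N &
      forall p, U p -> gauss_curvature x p != 0].

Definition relative_normalization (s : nat) U x y : Prop :=
  [/\ Ck s U y,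
      forall p, U p -> \rank (col_mx (jac x p) (y p)) = 3%N &
      forall p i, U p -> \rank (col_mx (jac x p) (partial i y p)) = 2%N].

(* The entry (i, j) is B_i^j. The lemmas shapeE and shape_uniq below show that
   this is the unique solution of d_i y = - B_i^j d_j x. *)
Definition shape x y p : 'M[R]_2 := - (jac y p *m pinvmx (jac x p)).

Definition rel_curvature x y p : R := \det (shape x y p).

Definition rel_mean_curvature x y p : R := \tr (shape x y p) / 2%:R.

Definition parallel_map (mu : R) x y : 'rV[R]_2 -> 'rV[R]_3 :=
  fun p => x p + mu *: y p.

(* (parallel_map mu x y, y) is a relatively parallel surface to (x, y); for
   such mu, lemma parallel_regular below applies. *)
Definition relatively_parallel (mu : R) U x y : Prop :=
  mu != 0 /\ forall p, U p ->
    mu ^+ 2 * rel_curvature x y p - 2%:R * mu * rel_mean_curvature x y p + 1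
      != 0.

Lemma shapeE s U x y p :
  (forall p, U p -> \rank (jac x p) = 2%N) ->
  relative_normalization s U x y -> U p ->
  jac y p = - (shape x y p *m jac x p).
Proof.
move=> hx [_ _ hy] Up; rewrite /shape mulNmx opprK mulmxKpV//.
apply/row_subP => i; rewrite rowK.
have sJ : (jac x p <= col_mx (jac x p) (partial i y p))%MS.
  by rewrite -addsmxE addsmxSl.
have := mxrank_leqif_eq sJ; rewrite hx// hy// => -[_ /esym].
rewrite eqxx => /andP[_]; apply: submx_trans.
by rewrite -addsmxE addsmxSr.
Qed.

Lemma shape_uniq x y p (B : 'M[R]_2) :
  \rank (jac x p) = 2%N -> jac y p = - (B *m jac x p) -> B = shape x y p.
Proof.
move=> hx hB; have fx : row_free (jac x p) by rewrite /row_free hx.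
apply: (row_free_inj fx).
by rewrite /shape mulNmx mulmxKpV hB ?opprK// eqmx_opp submxMl.
Qed.

Lemma jac_parallel (r s : nat) U x y mu p :
  Ck r.+1 U x -> Ck s.+1 U y -> U p ->
  jac (parallel_map mu x y) p = jac x p + mu *: jac y p.
Proof.
move=> hx hy Up; apply/row_matrixP => i.
have [dx _] := hx i; have [dy _] := hy i.
rewrite linearD linearZ /= !rowK /partial.
have -> : parallel_map mu x y = x + (mu \*: y) by [].
rewrite (deriveD (dx _ Up) (derivableZ (k:=mu) (dy _ Up))).
by rewrite (deriveZ mu (dy _ Up)).
Qed.

Lemma det_mx2 (A : 'M[R]_2) : \det A = A 0 0 * A 1 1 - A 0 1 * A 1 0.
Proof.
rewrite (expand_det_row _ 0) !big_ord_recl big_ord0 addr0 /cofactor !det_mx11.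
rewrite !mxE /= expr0 expr1 mul1r mulN1r mulrN.
by do ![congr (_ * _) || congr (_ - _) || congr (A _ _) || apply: val_inj].
Qed.

Lemma rank_col_mx_eq (m n k : nat) (A B : 'M[R]_(m, n)) (C : 'M[R]_(k, n)) :
  (A :=: B)%MS -> \rank (col_mx A C) = \rank (col_mx B C).
Proof. by move=> AB; rewrite -!addsmxE; apply/eqmx_rank/eqmxP/adds_eqmx. Qed.

Lemma parallel_regular (r s : nat) U x y mu :
  surface r.+1 U x -> relative_normalization s.+1 U x y ->
  relatively_parallel mu U x y ->
  (forall p, U p -> \rank (jac (parallel_map mu x y) p) = 2%N) /\
  relative_normalization s.+1 U (parallel_map mu x y) y.
Proof.
move=> [cx _ hx _] hy [_ hA].
have eqJ p : U p -> (jac (parallel_map mu x y) p :=: jac x p)%MS.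
  move=> Up; have [cy _ _] := hy.
  rewrite (jac_parallel _ cx cy Up) (shapeE hx hy Up) scalerN scalemxAl.
  rewrite -[X in X - _]mul1mx -mulmxBl; apply: eqmxMfull.
  rewrite row_full_unit unitmxE unitfE.
  have := hA _ Up; rewrite /rel_curvature /rel_mean_curvature.
  move: (shape x y p) => B; apply: contra_neq => h; rewrite -[RHS]h !det_mx2.
  rewrite /mxtrace !big_ord_recl big_ord0 !mxE /= !mulr0n !mulr1n.
  have -> : lift ord0 ord0 = 1 :> 'I_2 by apply: val_inj.
  have -> : ord0 = 0 :> 'I_2 by apply: val_inj.
  by field.
split=> [p Up|]; first by rewrite eqJ// hx.
have [cy hy3 hy2] := hy; split; first exact: cy.
- by move=> p Up; rewrite (rank_col_mx_eq _ (eqJ p Up)) hy3.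
- by move=> p i Up; rewrite (rank_col_mx_eq _ (eqJ p Up)) hy2.
Qed.

End Surface.

(* Main.v *)
(** By Cayley-Hamilton, [(B - mu K) (1 - mu B) = A B] for a 2 x 2 matrix [B],
    so the shape matrix of the parallel surface is [A^-1 (B - mu K)], whence
    [K* = K / A] and [H* = (H - mu K) / A]. With [H = h] constant, [K*] is
    [4 h^2] for [mu = 1 / (2 h)] and [H*] is [- h] for [mu = 1 / h]. These
    distances are singular only when [K = 0], resp. [K = h^2]; if this holds
    identically, all curvatures are constant and other distances do. *)
Require Import Defs.
From mathcomp Require Import all_boot all_order all_algebra.
From mathcomp Require Import all_classical all_reals all_analysis.
From mathcomp Require Import ring.

Set Implicit Arguments.
Unset Strict Implicit.

Import Order.TTheory GRing.Theory Num.Theory.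
Import numFieldNormedType.Exports.

Local Open Scope classical_set_scope.
Local Open Scope ring_scope.

Lemma mxtrace2 (R : nzRingType) (B : 'M[R]_2) : \tr B = B 0 0 + B 1 1.
Proof.
rewrite /mxtrace !big_ord_recl big_ord0 addr0.
by congr (B _ _ + B _ _); apply: val_inj.
Qed.

Lemma cayley_hamilton2 (R : realType) (B : 'M[R]_2) :
  B *m B = \tr B *: B - (\det B)%:M.
Proof.
have ord2 (i : 'I_2) : i = 0 \/ i = 1.
  by case: i => [[|[|//]] ?]; [left | right]; apply: val_inj.
have lift01 : lift ord0 ord0 = 1 :> 'I_2 by apply: val_inj.
apply/matrixP => i j; rewrite mxtrace2 det_mx2 !mxE !big_ord_recl big_ord0 lift01.
by case: (ord2 i) => ->; case: (ord2 j) => ->; rewrite ?mulr1n ?mulr0n /=; ring.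
Qed.

Lemma det_sub_scalar2 (R : realType) (B : 'M[R]_2) (k : R) :
  \det (B - k%:M) = \det B - k * \tr B + k ^+ 2.
Proof. by rewrite mxtrace2 !det_mx2 !mxE /= !mulr1n !mulr0n; ring. Qed.

Section Parallel.
Variables (R : realType) (r s : nat) (U : set 'rV[R]_2).
Variables (x y : 'rV[R]_2 -> 'rV[R]_3) (mu : R) (p : 'rV[R]_2).
Hypotheses (hx : surface r.+1 U x) (hy : relative_normalization s.+1 U x y).
Hypotheses (hmu : relatively_parallel mu U x y) (Up : U p).

Let K := rel_curvature x y p.
Let H := rel_mean_curvature x y p.
Let A := mu ^+ 2 * K - 2%:R * mu * H + 1.

Let A_neq0 : A != 0. Proof. by case: hmu => _; apply. Qed.

Let trB : \tr (Defs.shape x y p) = 2%:R * H.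
Proof. by rewrite /H /rel_mean_curvature mulrC divfK// pnatr_eq0. Qed.

(** With [B] and [J] for the shape matrix and [jac x p], the parallel map has Jacobian
    [(1 - mu B) J], while [jac y p] is [- B J]. By [shape_uniq] it is enough that the claimed matrix
    times [1 - mu B] gives [B]. *)
Lemma shape_parallel :
  Defs.shape (parallel_map mu x y) y p = A^-1 *: (Defs.shape x y p - (mu * K)%:M).
Proof.
have [rk _] := parallel_regular hx hy hmu.
have [cx _ rkx _] := hx; have [cy _ _] := hy.
symmetry; apply: shape_uniq; first exact: rk.
rewrite (jac_parallel _ cx cy Up) (shapeE rkx hy Up); congr (- _).
rewrite scalerN scalemxAl -[X in _ *m (X - _)]mul1mx -mulmxBl mulmxA; congr (_ *m _).
apply: (scalerI A_neq0); rewrite -scalemxAl scalerA divff// scale1r.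
rewrite mulmxBr mulmx1 mulmxBl -!scalemxAr cayley_hamilton2 trB.
rewrite mul_scalar_mx -/(rel_curvature x y p) -/K.
(* Once the square of [B] is eliminated, both sides are linear in [B] and the identity, so entries
   can be compared. *)
rewrite /A; move: (K) (H) (Defs.shape x y p) => k m B; apply/matrixP => i j.
by rewrite !mxE; case: (i == j); rewrite /= ?mulr1n ?mulr0n; ring.
Qed.

Lemma rel_curvature_parallel : rel_curvature (parallel_map mu x y) y p = K / A.
Proof.
rewrite {1}/rel_curvature shape_parallel detZ.
rewrite det_sub_scalar2 trB -/(rel_curvature x y p) -/K.
(* The determinant of [B - mu K] is [K A], and one of the two factors [A^-1] from [detZ] cancels
   this [A]. *)
have -> : K - mu * K * (2%:R * H) + (mu * K) ^+ 2 = K * A by rewrite /A; ring.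
by field.
Qed.

Lemma rel_mean_curvature_parallel :
  rel_mean_curvature (parallel_map mu x y) y p = (H - mu * K) / A.
Proof.
rewrite {1}/rel_mean_curvature shape_parallel mxtraceZ raddfB /= trB mxtrace_scalar.
by field.
Qed.

End Parallel.

Theorem proposition3p3 (R : realType) (r s : nat) (U : set 'rV[R]_2)
  (x y : 'rV[R]_2 -> 'rV[R]_3) (h : R)
  (hr : (3 <= r)%N) (hs : (1 <= s)%N) (hsr : (s < r)%N)
  (hU : region U)
  (hx : surface r U x)
  (hy : relative_normalization s U x y)
  (hreal : forall p, U p ->
     0 <= rel_mean_curvature x y p ^+ 2 - rel_curvature x y p)
  (hH : forall p, U p -> rel_mean_curvature x y p = h)
  (h0 : h != 0) :
  exists mu nu : R, [/\ mu != nu,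
    nowhere_or_identically_zero U (rel_curvature x y) ->
      relatively_parallel mu U x y /\
      constant_on U (rel_curvature (parallel_map mu x y) y) &
    nowhere_or_identically_zero U
      (fun p => rel_mean_curvature x y p ^+ 2 - rel_curvature x y p) ->
      relatively_parallel nu U x y /\
      constant_on U (rel_mean_curvature (parallel_map nu x y) y)].
Proof.
case: r hr hsr hx => // r' _ _ {}hx; case: s hs hy => // s' _ {}hy.
pose K := rel_curvature x y.
(* The disjunction keeps the possible values of [mu], from which [mu != nu] is derived at the
   end. *)
have [mu mu2 Kmu] : exists2 mu, mu = 2%:R / h \/ mu = (2%:R * h)^-1 &
    nowhere_or_identically_zero U K -> relatively_parallel mu U x y /\
      constant_on U (rel_curvature (parallel_map mu x y) y).
  have [K0|nK0] := pselect (forall p, U p -> K p = 0).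
    (* Here [A = 1 - 2 mu h] vanishes only at [mu = 1 / (2 h)]; the choice [2 / h] gives
       [A = -3]. *)
    exists (2%:R / h); [by left|move=> _].
    have hmu : relatively_parallel (2%:R / h) U x y.
      split=> [|p Up]; first by rewrite mulf_neq0 ?invr_eq0 ?pnatr_eq0.
      rewrite -/(K p) K0// hH//.
      have -> : (2%:R / h) ^+ 2 * 0 - 2%:R * (2%:R / h) * h + 1 = - 3%:R :> R.
        by field.
      by rewrite oppr_eq0 pnatr_eq0.
    split=> //; exists 0 => p Up.
    by rewrite (rel_curvature_parallel hx hy hmu Up) -/(K p) K0// mul0r.
  (* This distance makes [2 mu h = 1], which cancels the constant term of [A] and leaves a multiple
     of [K]. *)
  exists (2%:R * h)^-1; [by right|case=> // Kn0].
  have AE p : U p -> (2%:R * h)^-1 ^+ 2 * K p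
      - 2%:R * (2%:R * h)^-1 * rel_mean_curvature x y p + 1 =
      K p / (4%:R * h ^+ 2).
    by move=> Up; rewrite hH//; field.
  have hmu : relatively_parallel (2%:R * h)^-1 U x y.
    split=> [|p Up]; first by rewrite invr_eq0 mulf_neq0 ?pnatr_eq0.
    rewrite AE// mulf_neq0 ?Kn0// invr_eq0 mulf_neq0 ?pnatr_eq0//.
    by rewrite expf_neq0.
  split=> //; exists (4%:R * h ^+ 2) => p Up.
  rewrite (rel_curvature_parallel hx hy hmu Up) AE//.
  by have := Kn0 p Up; rewrite -/(K p) => ?; field; apply/andP; split.
have [nu nu2 Hnu] : exists2 nu, nu = - h^-1 \/ nu = h^-1 &
    nowhere_or_identically_zero U (fun p => rel_mean_curvature x y p ^+ 2 - K p) ->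
      relatively_parallel nu U x y /\
      constant_on U (rel_mean_curvature (parallel_map nu x y) y).
  have [D0|nD0] :=
      pselect (forall p, U p -> rel_mean_curvature x y p ^+ 2 - K p = 0).
    have KE p : U p -> K p = h ^+ 2.
      by move=> Up; apply/esym/eqP; rewrite -subr_eq0 -(hH p Up) D0.
    (* With [K = h^2], [A] is [(1 - nu h)^2], zero only at [nu = 1 / h]. The opposite distance gives
       [A = 4] and keeps [(nu h)^2 = 1]. *)
    exists (- h^-1); [by left|move=> _].
    have hnu : relatively_parallel (- h^-1) U x y.
      split=> [|p Up]; first by rewrite oppr_eq0 invr_eq0.
      rewrite -/(K p) KE// hH//.
      have -> : (- h^-1) ^+ 2 * h ^+ 2 - 2%:R * - h^-1 * h + 1 = 4%:R by field.
      by rewrite pnatr_eq0.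
    split=> //; exists (h / 2%:R) => p Up.
    rewrite (rel_mean_curvature_parallel hx hy hnu Up) -/(K p) KE// hH//.
    have -> : (- h^-1) ^+ 2 * h ^+ 2 - 2%:R * - h^-1 * h + 1 = 4%:R by field.
    by field.
  (* Now both [A] and [H - nu K] are multiples of [h^2 - K], which cancels in the quotient. *)
  exists h^-1; [by right|case=> // Dn0].
  have AE p : U p -> h^-1 ^+ 2 * K p
      - 2%:R * h^-1 * rel_mean_curvature x y p + 1 = - (h ^+ 2 - K p) / h ^+ 2.
    by move=> Up; rewrite hH//; field.
  have hnu : relatively_parallel h^-1 U x y.
    split=> [|p Up]; first by rewrite invr_eq0.
    rewrite AE// mulf_neq0 ?invr_eq0 ?expf_neq0// oppr_eq0 -(hH p Up).
    exact: Dn0.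
  split=> //; exists (- h) => p Up.
  rewrite (rel_mean_curvature_parallel hx hy hnu Up) AE// -/(K p) hH//.
  have := Dn0 p Up; rewrite hH// => d0.
  have -> : h - h^-1 * K p = (h ^+ 2 - K p) / h by field.
  by move: (h ^+ 2 - K p) d0 => d d0; field; rewrite h0 d0.
(* In every combination of cases [(nu h)^2] is 1, whereas [(mu h)^2] is 4 or 1/4. *)
exists mu, nu; split=> //; apply/eqP => e.
have /eqP : (mu * h) ^+ 2 = (nu * h) ^+ 2 by rewrite e.
have -> : (nu * h) ^+ 2 = 1 by case: nu2 => ->; field.
case: mu2 => ->.
  have -> : (2%:R / h * h) ^+ 2 = 4%:R :> R by field.
  by rewrite (eqr_nat R 4 1).
have -> : ((2%:R * h)^-1 * h) ^+ 2 = 4%:R^-1 :> R by field.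
by rewrite invr_eq1 (eqr_nat R 4 1).
Qed.
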